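(* Let $U=\bigcup U_i\subset\mathbb{R}^n$ be a finite union of open convex bodies $U_i$. For each $i$ such that the tail cone $\mathrm{tail}(U_i)$ is a vector space, put $L_i=\mathrm{tail}(U_i)$ and let $a_i$ be an arbitrary point in $U_i$. Suppose that all the linear spaces $L_i$ are equal to the same linear space $L$, and let $T$ be a subspace transversal to $L$, i.e. a linear subspace of $\mathbb{R}^n$ such that $\mathbb{R}^n=T\oplus L$. Then the set $\mathbb{R}^n\setminus U$ is homotopy equivalent to $T\setminus\{b_i\}$, where $b_i=T\cap\{a_i+L_i\}$ and $i$ runs over all indices such that $\mathrm{tail}(U_i)$ is a vector space.
   Context: Convex bodies here are not required to be bounded. The tail cone $\mathrm{tail}(U)$ of a convex body $U\subset\mathbb{R}^n$ is the set of points $v\in\mathbb{R}^n$ such that for any $a\in U$ and $t\ge0$ the inclusion $a+tv\in U$ holds. ''Is a vector space'' means that $\mathrm{tail}(U)$ is a linear subspace of $\mathbb{R}^n$ (possibly $\{0\}$).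
   Formalization: The open convex bodies U_i are assumed pairwise disjoint; without this the claim is false, e.g. U_1=(0,2), U_2=(1,3) in R with a_1=1/2, a_2=5/2: R\U has two components, T\{b_1,b_2} has three. *)

(* Defs.v *)
From HB Require Import structures.
From mathcomp Require Import all_boot all_order all_algebra.
From mathcomp Require Import all_classical all_reals.
From mathcomp Require Import topology normedtype convex.

Set Implicit Arguments.
Unset Strict Implicit.
Unset Printing Implicit Defensive.

Import Order.TTheory GRing.Theory Num.Theory.
Import numFieldNormedType.Exports.

Local Open Scope classical_set_scope.
Local Open Scope ring_scope.

(* R^n is 'rV[R]_n with its product topology. Convex bodies are nonempty, and
   need be neither bounded nor closed. *)
Definition open_convex_body (R : realType) (n : nat) (U : set 'rV[R]_n) : Prop :=
  [/\ U !=set0, open U & convex_set U].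

Definition tail (R : realType) (n : nat) (U : set 'rV[R]_n) : set 'rV[R]_n :=
  [set v | forall a t, U a -> 0 <= t -> U (a + t *: v)].

Definition is_linear_subspace (R : realType) (n : nat) (S : set 'rV[R]_n) : Prop :=
  exists L : {vspace 'rV[R]_n}, S = [set` L].

(* Only the values of H over the unit interval matter: H is required to be
   continuous for the subspace topology of `[0, 1] * X. *)
Definition homotopic (R : realType) (X Y : topologicalType) (f g : X -> Y) : Prop :=
  exists H : R * X -> Y,
    [/\ {within `[0, 1]%classic `*` [set: X], continuous H},
        forall x, H (0, x) = f x &
        forall x, H (1, x) = g x].

Definition homotopy_equivalent (R : realType) (X Y : topologicalType) : Prop :=
  exists (f : X -> Y) (g : Y -> X),
    [/\ continuous f, continuous g,
        homotopic R (g \o f) id &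
        homotopic R (f \o g) id].

(* Main.v *)
Require Import Defs.
From HB Require Import structures.
From mathcomp Require Import all_boot all_order all_algebra.
From mathcomp Require Import all_classical all_reals.
From mathcomp Require Import topology normedtype convex.
From mathcomp Require Import interval_inference ring lra.

Set Implicit Arguments.
Unset Strict Implicit.
Unset Printing Implicit Defensive.

Import Order.TTheory GRing.Theory Num.Theory.
Import numFieldNormedType.Exports.

Local Open Scope classical_set_scope.
Local Open Scope ring_scope.

(** Let J be the set of indices whose tail cone is a linear space, and let Z be
    the complement of the affine spaces [a i + L], i in J. Both spaces of the
    theorem are deformation retracts of Z, in both cases along straight
    segments: the complement X of the bodies by pushing every body to its
    boundary, and [T \ {b i}] by projecting along L, since [a i + L = b i + L].
    Two retracts of Z of this kind are homotopy equivalent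
    ([straight_retracts_homotopy_equivalent]), the maps between them being the
    restrictions of the two retractions.

    The second retraction is linear algebra
    ([projection_straight_retraction]). For the first, each body U is described
    by its Minkowski gauge g at a point p, so that U is [g (x - p) < 1] and
    tail U is [g v = 0] ([gauge_spec], [tail_gauge]). Radial projection from p
    pushes [U \ (p + tail U)] to the boundary; this settles the bodies with
    linear tail, whose [p + tail U] is missing from Z
    ([radial_pushes_out]). If tail U is not linear, it contains some v with -v
    outside it ([nonlinear_tail_gauge]). Then U can first be deformed inside
    itself off [p + tail U], by moving its points towards [p - v] for a suitably
    scaled v ([recession_shift]), and afterwards projected radially
    ([recession_pushes_out]); so nothing of U is missing from Z.

    As the bodies are open and disjoint, a point pushed to the boundary of one
    of them lies in no other, and the individual pushes, each the identity
    outside its body, add up to one continuous map ([pushes_out_glue]). *)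

(** * The Minkowski gauge of an open convex set *)

Section ConvexSets.
Context (R : realType) (V : normedModType R).
Implicit Types (U : set V) (p x y v : V) (g : V -> R) (t : R).

Lemma convex_segment U x y t :
  convex_set U -> U x -> U y -> 0 <= t -> t <= 1 -> U ((1 - t) *: x + t *: y).
Proof.
move=> Ucvx Ux Uy t0 t1.
pose l : {i01 R} := Itv01 t0 t1.
have := Ucvx y x l; rewrite !inE => /(_ Uy Ux).
by rewrite /conv /= addrC.
Qed.

(** The properties through which a gauge is used below: everything about U, its
    boundary and its tail cone is read off a sublinear function. *)
Definition is_gauge U p g : Prop :=
  [/\ continuous g,
      forall x, 0 <= g x,
      forall t x, 0 <= t -> g (t *: x) = t * g x,
      forall x y, g (x + y) <= g x + g y &
      forall x, U (p + x) <-> g x < 1].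

Definition dilations U p x : set R := [set t | 0 < t /\ U (p + t^-1 *: x)].

Definition gauge U p x : R := inf (dilations U p x).

Lemma gauge_le U p x t : 0 < t -> U (p + t^-1 *: x) -> gauge U p x <= t.
Proof.
move=> t0 Ut; apply: ge_inf => //.
by exists 0 => s [] /ltW.
Qed.

(** Convexity makes the set of admissible dilations upward closed and gives
    subadditivity; openness gives the strict inequality and, through a ball
    around p, a Lipschitz bound. *)
Lemma gauge_spec U p : open U -> convex_set U -> U p -> is_gauge U p (gauge U p).
Proof.
move=> Uo Ucvx Up.
have [r r0 rU] : exists2 r : R, 0 < r & forall x, `|x| < r -> U (p + x).
  have /nbhs_ballP[r r0 rU] : nbhs p U by exact: open_nbhs_nbhs.
  exists r => // x xr; apply: rU.
  by rewrite -ball_normE /= opprD addNKr normrN.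
have shrink t x : U (p + x) -> 0 <= t -> t <= 1 -> U (p + t *: x).
  move=> Ux t0 t1; have := convex_segment Ucvx Up Ux t0 t1.
  by rewrite scalerDr addrA -scalerDl subrK scale1r.
have dil_large x t : `|x| < r * t -> 0 < t -> dilations U p x t.
  move=> xt t0; split=> //; apply: rU.
  by rewrite normrZ gtr0_norm ?invr_gt0// mulrC ltr_pdivrMr.
have dil0 x : dilations U p x !=set0.
  exists ((`|x| + 1) / r); apply: dil_large; last by rewrite divr_gt0// ltr_wpDl.
  by rewrite mulrCA divff ?gt_eqF// mulr1 ltrDl.
have gauge_ge0 x : 0 <= gauge U p x by apply: lb_le_inf => // t [] /ltW.
have gauge_ltP x : U (p + x) <-> gauge U p x < 1.
  split=> [Ux|].
    have /nbhs_ballP[e e0 eU] : nbhs (p + x) U by exact: open_nbhs_nbhs.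
    pose d := e / (`|x| + 1).
    have d0 : 0 < d by rewrite divr_gt0// ltr_wpDl.
    suff : gauge U p x <= (1 + d)^-1.
      by move=> /le_lt_trans; apply; rewrite invf_lt1 ?ltrDl// addr_gt0.
    apply: gauge_le; first by rewrite invr_gt0 addr_gt0.
    rewrite invrK; apply: eU; rewrite -ball_normE /=.
    rewrite scalerDl scale1r addrA opprD addNKr normrN normrZ gtr0_norm//.
    by rewrite /d mulrAC ltr_pdivrMr ?ltr_wpDl// ltr_pM2l// ltrDl.
  move=> gx; have h : 0 < 1 - gauge U p x by rewrite subr_gt0.
  have dil_inf : has_inf (dilations U p x).
    by split => //; exists 0 => s [] /ltW.
  have [t [t0 Ut] tg] := inf_adherent h dil_inf.
  have t1 : t <= 1 by rewrite ltW// (lt_le_trans tg)// /gauge addrC subrK.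
  have := shrink t (t^-1 *: x) Ut (ltW t0) t1.
  by rewrite scalerA divff ?gt_eqF// scale1r.
have gauge_scale_le t x : 0 < t -> gauge U p (t *: x) <= t * gauge U p x.
  move=> t0; rewrite -ler_pdivrMl//; apply: lb_le_inf => // s [s0 Us].
  rewrite ler_pdivrMl//; apply: gauge_le; first exact: mulr_gt0.
  by rewrite scalerA invfM mulrAC mulVf ?gt_eqF// mul1r.
have gauge_scale t x : 0 <= t -> gauge U p (t *: x) = t * gauge U p x.
  rewrite le_eqVlt => /predU1P[<-|t0].
    rewrite scale0r mul0r; apply/eqP; rewrite eq_le gauge_ge0 andbT.
    apply/ler_addgt0Pl => e e0; rewrite addr0; apply: gauge_le => //.
    by rewrite scaler0 addr0.
  apply/eqP; rewrite eq_le gauge_scale_le//=.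
  have := gauge_scale_le t^-1 (t *: x); rewrite invr_gt0 => /(_ t0).
  by rewrite scalerA mulVf ?gt_eqF// scale1r -ler_pdivlMl ?invr_gt0// invrK.
have gaugeD x y : gauge U p (x + y) <= gauge U p x + gauge U p y.
  rewrite -lerBlDl; apply: lb_le_inf => // t [t0 Ut].
  rewrite lerBlDl -lerBlDr; apply: lb_le_inf => // s [s0 Us].
  rewrite lerBlDr; apply: gauge_le; first exact: addr_gt0.
  have st0 : 0 < s + t by exact: addr_gt0.
  have -> : p + (s + t)^-1 *: (x + y) =
      (1 - t / (s + t)) *: (p + s^-1 *: x) + (t / (s + t)) *: (p + t^-1 *: y).
    rewrite !scalerDr !scalerA addrACA -scalerDl subrK scale1r.
    congr (_ + (_ *: _ + _ *: _)).
    - by field; rewrite !gt_eqF.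
    - by field; rewrite !gt_eqF.
  apply: convex_segment => //; first by rewrite divr_ge0// ltW.
  by rewrite ler_pdivrMr// mul1r lerDr ltW.
split=> // x.
(* A ball of radius r inside U - p bounds the gauge by |y| / r; the factor 2
   only keeps the inequality strict. *)
have gauge_norm y : gauge U p y <= 2 / r * `|y|.
  have [->|y0] := eqVneq y 0.
    by rewrite normr0 mulr0 -(scale0r (0 : V)) gauge_scale// mul0r.
  apply: gauge_le; first by rewrite mulr_gt0 ?normr_gt0 ?divr_gt0.
  have [] := dil_large y (2 / r * `|y|) => //.
    rewrite mulrA mulrCA divff ?gt_eqF// mulr1.
    by rewrite ltr_pMl ?normr_gt0// ltr1n.
  by rewrite mulr_gt0 ?normr_gt0 ?divr_gt0.
have cvg_norm0 : (2 / r * `|y - x|) @[y --> x] --> (0 : R).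
  rewrite -[0](mulr0 (2 / r)) -(normr0 V) -(subrr x).
  by apply: cvgM; [exact: cvg_cst|apply: cvg_norm; apply: cvgB => //; exact: cvg_cst].
apply: (@squeeze_cvgr _ _ _ _ (fun y => gauge U p x - 2 / r * `|y - x|)
  (fun y => gauge U p x + 2 / r * `|y - x|)).
- apply: nearW => y; rewrite lerBlDr; apply/andP; split.
    rewrite -{1}(subrK y x) addrC -normrN opprB.
    by rewrite addrC (le_trans (gaugeD _ _))// addrC lerD2l.
  by rewrite -{1}(subrK x y) addrC (le_trans (gaugeD _ _))// lerD2l.
- by rewrite -[X in _ --> X]subr0; apply: cvgB => //; exact: cvg_cst.
- by rewrite -[X in _ --> X]addr0; apply: cvgD => //; exact: cvg_cst.
Qed.
End ConvexSets.

(** * Pushing a convex set to its boundary *)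

Section PushOut.
Context (R : realType) (V : normedModType R).
Implicit Types (U A : set V) (p x y v : V) (g : V -> R) (r : V -> V) (t s : R).

Lemma gaugeP U p g x : is_gauge U p g -> U x <-> g (x - p) < 1.
Proof. by case=> _ _ _ _ /(_ (x - p)) <-; rewrite addrC subrK. Qed.

Lemma gauge_segment U p g x y s : is_gauge U p g ->
  0 <= s -> s <= 1 -> g (x + s *: (y - x) - p) <= (1 - s) * g (x - p) + s * g (y - p).
Proof.
move=> [_ _ gZ gD _] s0 s1; rewrite -!gZ ?subr_ge0//.
apply: le_trans (gD _ _); rewrite le_eqVlt; apply/orP; left; apply/eqP; congr g.
rewrite scalerBl scale1r -[RHS]addrA [- _ + _]addrC -scalerBr.
by rewrite opprB addrA subrK addrAC.
Qed.

(** U is carried out of itself, but only just: x moves to r x along a segment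
    that stays in U until its last point. The exceptional set A is where no such
    push is asked for, and the segments never enter it. *)
Definition pushes_out U A r : Prop :=
  [/\ forall x, ~ A x -> {for x, continuous r},
      forall x, ~ U x -> r x = x &
      forall x, U x -> ~ A x ->
        ~ U (r x) /\
        forall s, 0 <= s -> s < 1 -> (U `\` A) (x + s *: (r x - x))].

(** The minimum with 1 makes the projection the identity where the gauge is at
    least 1, so that a single formula is continuous across the boundary. *)
Definition radial g p x : V := p + (Num.min (g (x - p)) 1)^-1 *: (x - p).

Lemma radial_id g p x : 1 <= g (x - p) -> radial g p x = x.
Proof. by move=> g1; rewrite /radial min_r// invr1 scale1r addrC subrK. Qed.

Lemma radial_boundary U p g x : is_gauge U p g -> 0 < g (x - p) < 1 ->
  g (radial g p x - p) = 1.
Proof.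
move=> [_ _ gZ _ _] /andP[g0 g1]; rewrite /radial min_l ?ltW//.
by rewrite [p + _]addrC addrK gZ ?invr_ge0 ?ltW// mulVf ?gt_eqF.
Qed.

Lemma radial_continuous U p g x : is_gauge U p g -> 0 < g (x - p) ->
  {for x, continuous (radial g p)}.
Proof.
move=> [gc _ _ _ _] g0.
have subc : {for x, continuous (fun y => y - p)}.
  by apply: cvgB => //; exact: cvg_cst.
apply: cvgD; first exact: cvg_cst.
apply: cvgZ => //; apply: cvgV; first by rewrite gt_eqF// lt_min g0 ltr01.
apply: (@continuous_min _ _ (fun y => g (y - p)) (cst 1)); last exact: cvg_cst.
by apply: (continuous_comp subc); exact: gc.
Qed.

(** Along the ray from p through x the gauge is proportional to the distance
    from p, so it stays positive and reaches 1 at the projection only. *)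
Lemma radial_pushes_out U p g : is_gauge U p g ->
  pushes_out U [set x | g (x - p) = 0] (radial g p).
Proof.
move=> gU; have [_ g_ge0 gZ _ _] := gU.
have gpos x : g (x - p) <> 0 -> 0 < g (x - p).
  by move=> /eqP; rewrite lt_neqAle g_ge0 andbT eq_sym.
split=> [x /gpos|x|x Ux /gpos gx0]; first exact: (radial_continuous gU).
  by move=> /(gaugeP x gU)/negP; rewrite -leNgt; exact: radial_id.
have gx1 := (gaugeP x gU).1 Ux.
have gr1 : g (radial g p x - p) = 1 by rewrite (radial_boundary gU)// gx0.
split=> [/(gaugeP _ gU)|s s0 s1]; first by rewrite gr1 ltxx.
split.
  apply/(gaugeP _ gU)/(le_lt_trans (gauge_segment _ _ gU s0 (ltW s1))).
  by rewrite gr1 mulr1 -ltrBrDr -[ltRHS]mulr1 ltr_pM2l ?subr_gt0.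
suff E : x + s *: (radial g p x - x) - p =
    (1 - s + s * (g (x - p))^-1) *: (x - p).
  apply/eqP; rewrite /= E gZ; last first.
    by rewrite addr_ge0 ?mulr_ge0 ?invr_ge0 ?g_ge0// subr_ge0 ltW.
  rewrite mulf_neq0 ?gt_eqF// ltr_wpDr// ?subr_gt0//.
  by rewrite mulr_ge0 ?invr_ge0// ltW.
rewrite /radial min_l ?ltW// addrAC scalerDl scalerBl scale1r -[RHS]addrA.
congr (_ + _); rewrite -scalerA [RHS]addrC -scalerBr; congr (_ *: _).
by rewrite opprB [p + _]addrC -addrA.
Qed.

(** Points of U are moved towards [p - v], by a fraction [sg] that vanishes
    outside U and is below 1. Writing u for x - p, a point with [0 < g u] keeps a
    positive gauge, as [g v = 0]. A point with [g u = 0] is sent to a positive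
    multiple of [u - w v], whose gauge is positive as soon as w is large compared
    with [g (- u)], because [g (- v) > 0]. Since [p - v] and x are in the convex
    set U, no point leaves U. *)
Lemma recession_shift U p g v : is_gauge U p g -> g v = 0 -> 0 < g (- v) ->
  exists F : V -> V,
    [/\ continuous F, forall x, ~ U x -> F x = x,
        forall x, U x -> U (F x) &
        forall x, 0 < g (F x - p)].
Proof.
move=> gU gv0 gNv; have [gc g_ge0 gZ gD _] := gU.
(* Rescaling v puts p - v inside U. *)
wlog gNv2 : v gv0 gNv / g (- v) = 1 / 2 => [hwlog|].
  have c0 : 0 <= (2 * g (- v))^-1 by rewrite invr_ge0 mulr_ge0// ltW.
  apply: (hwlog ((2 * g (- v))^-1 *: v)).
  - by rewrite gZ// gv0 mulr0.
  - by rewrite -scalerN gZ// mulr_gt0// invr_gt0 mulr_gt0.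
  - by rewrite -scalerN gZ//; field; rewrite gt_eqF.
(* w is chosen to make g (w (- v)) exceed g (- u) by exactly 1. *)
pose w u := 2 * (g (- u) + 1).
have w0 u : 0 < w u by rewrite mulr_gt0// ltr_wpDl.
pose sg u := Num.max 0 (1 - g u) * (w u / (w u + 1)).
have q1 u : 0 < w u / (w u + 1) < 1.
  by rewrite divr_gt0 ?addr_gt0//= ltr_pdivrMr ?addr_gt0// mul1r ltrDl.
have sg0 u : 0 <= sg u.
  by have /andP[/ltW q0 _] := q1 u; rewrite mulr_ge0// le_max lexx.
have sg1 u : sg u < 1.
  have /andP[q0 ql] := q1 u; apply: le_lt_trans ql.
  rewrite -[leRHS]mul1r ler_pM2r// ge_max ler01/=.
  by rewrite gerBl.
have sg_out u : 1 <= g u -> sg u = 0.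
  by move=> gu; rewrite /sg max_l ?mul0r// subr_le0.
pose F x := (1 - sg (x - p)) *: x + sg (x - p) *: (p - v).
have FE x : F x - p = (1 - sg (x - p)) *: (x - p) + sg (x - p) *: (- v).
  rewrite /F; move: (sg _) => c.
  rewrite !scalerBr scalerN addrA [LHS]addrAC; congr (_ + _).
  by rewrite -addrA; congr (_ + _); rewrite scalerBl scale1r opprB.
exists F; split=> [x|x|x|x].
- have subc : {for x, continuous (fun y => y - p)}.
    by apply: cvgB => //; exact: cvg_cst.
  have gsub : {for x, continuous (fun y => g (y - p))}.
    by apply: (continuous_comp subc); exact: gc.
  have wsub : {for x, continuous (fun y => w (y - p))}.
    apply: cvgM; first exact: cvg_cst.
    apply: cvgD; last exact: cvg_cst.
    apply: (@continuous_comp _ _ _ (fun y => - (y - p)) g); last exact: gc.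
    exact: cvgN.
  have sgc : {for x, continuous (fun y => sg (y - p))}.
    apply: cvgM.
      apply: (@continuous_max _ _ (cst 0) (fun y => 1 - g (y - p))).
        exact: cvg_cst.
      by apply: cvgB => //; exact: cvg_cst.
    apply: cvgM => //; apply: cvgV; first by rewrite gt_eqF ?addr_gt0.
    by apply: cvgD => //; exact: cvg_cst.
  apply: cvgD; first apply: cvgZ => //.
    by apply: cvgB => //; exact: cvg_cst.
  by apply: cvgZ => //; exact: cvg_cst.
- move=> /(gaugeP x gU)/negP; rewrite -leNgt => /sg_out sgx.
  by rewrite /F sgx subr0 scale1r scale0r addr0.
- move=> /(gaugeP x gU) gx; apply/(gaugeP _ gU); rewrite FE.
  apply: (le_lt_trans (gD _ _)); rewrite !gZ ?subr_ge0 ?(ltW (sg1 _))// gNv2.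
  have := sg0 (x - p); have := sg1 (x - p); move: (sg _) (g_ge0 (x - p)) => c.
  by nra.
- rewrite FE; have [gx1|gx1] := leP 1 (g (x - p)).
    rewrite sg_out// subr0 scale1r scale0r addr0; exact: lt_le_trans gx1.
  have [gx0|gx0] := eqVneq (g (x - p)) 0.
    rewrite /sg gx0 subr0 max_r// mul1r; move: (x - p) gx0 (w0 (x - p)) => u gu wu.
    have -> : (1 - w u / (w u + 1)) *: u + (w u / (w u + 1)) *: (- v) =
        (w u + 1)^-1 *: (u + w u *: - v).
      rewrite scalerDr scalerA [_^-1 * _]mulrC; congr (_ *: _ + _).
      by field; rewrite gt_eqF// addr_gt0.
    rewrite gZ ?invr_ge0 ?addr_ge0 ?ltW// mulr_gt0 ?invr_gt0 ?addr_gt0//.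
    have := gD (u + w u *: - v) (- u); rewrite addrAC subrr add0r (gZ _ _ (ltW wu)).
    by rewrite gNv2 /w; lra.
  have gp : 0 < g (x - p) by rewrite lt_neqAle g_ge0 eq_sym gx0.
  have sg1' : 0 < 1 - sg (x - p) by rewrite subr_gt0.
  have := gD ((1 - sg (x - p)) *: (x - p) + sg (x - p) *: - v) (sg (x - p) *: v).
  rewrite scalerN subrK !gZ ?(ltW sg1')// gv0 mulr0 addr0.
  by apply: lt_le_trans; rewrite mulr_gt0.
Qed.

(** Once shifted off [p + tail U], every point has a radial projection. The
    segment to it stays in U by convexity of the gauge, although it need not
    follow the path of the two successive moves. *)
Lemma recession_pushes_out U p g v : is_gauge U p g -> g v = 0 -> 0 < g (- v) ->
  exists r, pushes_out U set0 r.
Proof.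
move=> gU gv0 gNv; have [F [Fc Fout FU Fpos]] := recession_shift gU gv0 gNv.
exists (radial g p \o F); split=> [x _|x Ux|x Ux _] /=.
- by apply: continuous_comp; [exact: Fc|exact: (radial_continuous gU)].
- rewrite Fout// radial_id//.
  by move/(gaugeP x gU)/negP : Ux; rewrite -leNgt.
have gF1 := (gaugeP _ gU).1 (FU _ Ux).
have gr1 : g (radial g p (F x) - p) = 1 by rewrite (radial_boundary gU)// Fpos.
split=> [/(gaugeP _ gU)|s s0 s1]; first by rewrite gr1 ltxx.
split=> //; apply/(gaugeP _ gU)/(le_lt_trans (gauge_segment _ _ gU s0 (ltW s1))).
rewrite gr1 mulr1 -ltrBrDr -[ltRHS]mulr1 ltr_pM2l ?subr_gt0//.
exact/(gaugeP _ gU).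
Qed.

End PushOut.

(** * Tail cones of convex bodies *)

Section Tails.
Context (R : realType) (n : nat).
Implicit Types (U : set 'rV[R]_n) (p a v : 'rV[R]_n).

(** A subspace of maximal dimension inside S must be all of S, as it could
    otherwise be enlarged by one more vector. *)
Lemma linear_subspaceP (S : set 'rV[R]_n) :
  S 0 -> (forall x y, S x -> S y -> S (x + y)) ->
  (forall t x, S x -> S (t *: x)) -> is_linear_subspace S.
Proof.
move=> S0 SD SZ.
pose P d := `[< exists2 W : {vspace 'rV[R]_n}, \dim W = d & [set` W] `<=` S >].
have P0 : exists d, P d.
  exists 0%N; apply/asboolP; exists 0%VS; first exact: dimv0.
  by move=> x /=; rewrite memv0 => /eqP ->.
have Pmax d : P d -> (d <= \dim {:'rV[R]_n})%N.
  by move=> /asboolP[W <- _]; exact/dimvS/subvf.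
case: (ex_maxnP P0 Pmax) => d /asboolP[W dW WS] dmax.
exists W; apply/seteqP; split=> // x Sx; apply: contrapT => /negP/= xW.
have /dmax : P (\dim (W + <[x]>)%VS).
  apply/asboolP; exists (W + <[x]>)%VS => // y /=.
  move=> /memv_addP[w wW [_ /vlineP[k ->] ->]].
  by apply: SD; [exact: WS|exact: SZ].
rewrite -dW; apply/negP; rewrite -ltnNge (ltn_leqif (dimv_leqif_sup (addvSl _ _))).
by apply: contra xW => /subvP; apply; apply: (subvP (addvSr W <[x]>)); exact: memv_line.
Qed.

(** If [g v > 0] then the point [p + t v] with [t = 1 / g v] is outside U;
    conversely a direction of gauge zero never increases the gauge. *)
Lemma tail_gauge U p (g : 'rV[R]_n -> R) :
  is_gauge U p g -> tail U = [set v | g v = 0].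
Proof.
move=> gU; have [_ g_ge0 gZ gD gP] := gU.
apply/seteqP; split=> v /=.
  move=> Uv; apply/eqP; rewrite -[_ == _]negbK; apply/negP => gv0.
  have gv : 0 < g v by rewrite lt_neqAle g_ge0 eq_sym gv0.
  have Up : U p.
    by apply/(gaugeP _ gU); rewrite subrr -(scale0r (0 : 'rV_n)) gZ// mul0r.
  have vinv : 0 <= (g v)^-1 by rewrite invr_ge0 ltW.
  by have /gP := Uv p _ Up vinv; rewrite gZ// mulVf// ltxx.
move=> gv0 a t /(gaugeP _ gU) ga t0; apply/(gaugeP _ gU).
by rewrite addrAC (le_lt_trans (gD _ _))// gZ// gv0 mulr0 addr0.
Qed.

(** A tail cone is already closed under sums and nonnegative multiples, so only
    the failure of symmetry can prevent it from being linear. *)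
Lemma nonlinear_tail_gauge U p (g : 'rV[R]_n -> R) : is_gauge U p g ->
  ~ is_linear_subspace (tail U) -> exists2 v, g v = 0 & 0 < g (- v).
Proof.
move=> gU; have [_ g_ge0 gZ gD _] := gU; rewrite (tail_gauge gU) => nlin.
apply: contrapT => noray; apply: nlin.
have gN v : g v = 0 -> g (- v) = 0.
  move=> gv0; apply/eqP/negPn/negP => gNv; apply: noray.
  by exists v => //; rewrite lt_neqAle g_ge0 eq_sym gNv.
apply: linear_subspaceP => /=.
- by rewrite -(scale0r (0 : 'rV_n)) gZ// mul0r.
- move=> x y gx gy; apply/eqP; rewrite eq_le g_ge0 andbT.
  by rewrite (le_trans (gD _ _))// gx gy addr0.
- move=> t x gx; have [t0|/ltW t0] := leP 0 t; first by rewrite gZ// gx mulr0.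
  by rewrite -[t]opprK scaleNr -scalerN gZ ?oppr_ge0// gN// mulr0.
Qed.

(** The exceptional set is [a + tail U] or empty, according to whether the tail
    is linear; the second case is where the bodies with nonlinear tail
    disappear from the homotopy type. *)
Lemma body_pushes_out U a :
  open_convex_body U -> (is_linear_subspace (tail U) -> U a) ->
  exists r, pushes_out U
    [set x | is_linear_subspace (tail U) /\ tail U (x - a)] r.
Proof.
move=> [[p Up] Uo Ucvx] Ua; have [lin|nlin] := pselect (is_linear_subspace (tail U)).
  have gU := gauge_spec Uo Ucvx (Ua lin).
  exists (radial (gauge U a) a).
  rewrite (_ : [set x | _] = [set x | gauge U a (x - a) = 0]).
    exact: radial_pushes_out.
  apply/seteqP; split=> x /=; first by case; rewrite (tail_gauge gU).
  by move=> gx; split=> //; rewrite (tail_gauge gU).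
have gU := gauge_spec Uo Ucvx Up.
have [v gv gNv] := nonlinear_tail_gauge gU nlin.
have [r rU] := recession_pushes_out gU gv gNv.
exists r; rewrite (_ : [set x | _] = set0)//.
by apply/seteqP; split=> x //= -[].
Qed.

End Tails.

(** * Retractions along straight segments *)

Section StraightRetraction.
Context (R : realType) (V : normedModType R).
Implicit Types (U A X Y Z : set V) (h r : V -> V).

(** r retracts Z onto X, and the linear interpolation between the identity and
    r stays in Z, so it is a deformation retraction. Continuity is required at the
    points of Z with respect to the whole space, which suits open Z. *)
Definition straight_retraction Z X r : Prop :=
  [/\ X `<=` Z,
      forall z, Z z -> {for z, continuous r},
      forall x, X x -> r x = x,
      forall z, Z z -> X (r z) &
      forall z s, Z z -> 0 <= s -> s <= 1 -> Z (z + s *: (r z - z))].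

Definition corestrict (T : Type) X (k : T -> V) (kX : forall t, X (k t)) : T -> X :=
  fun t => SigSub (mem_set (kX t)).

Lemma corestrict_continuous (T : topologicalType) X (k : T -> V)
  (kX : forall t, X (k t)) : continuous k -> continuous (corestrict kX).
Proof. by move=> kc; apply: continuous_comp_initial. Qed.

Lemma val_continuous X : continuous (fun x : X => val x).
Proof. exact: (@initial_continuous X V set_val). Qed.

Lemma set_val_mem X (x : X) : X (val x).
Proof. exact: set_mem (valP x). Qed.

Lemma restrict_continuous Z Y r : straight_retraction Z Y r ->
  forall X, X `<=` Z -> continuous (fun x : X => r (val x)).
Proof.
move=> [_ rc _ _ _] X XZ x; apply: (@continuous_comp _ _ _ (fun x : X => val x)).
  exact: val_continuous.
exact: (rc _ (XZ _ (set_val_mem x))).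
Qed.

(** Homotopies are total functions of a real parameter; clamping it to the unit
    interval keeps them in their target and makes them continuous everywhere. *)
Definition clamp (s : R) : R := Num.max 0 (Num.min 1 s).

Lemma clamp_ge0 s : 0 <= clamp s.
Proof. by rewrite le_max lexx. Qed.

Lemma clamp_le1 s : clamp s <= 1.
Proof. by rewrite ge_max ler01 ge_min lexx. Qed.

Lemma clamp_continuous : continuous clamp.
Proof.
move=> s; apply: (@continuous_max R R (cst 0) (cst 1 \min id)).
  exact: cvg_cst.
by apply: (@continuous_min R R (cst 1) id); [exact: cvg_cst|exact: cvg_id].
Qed.

(** The segment from x to q x lies in Z, so r carries it into X. Its image joins
    [r x = x] to [r (q x) = g (f x)]. *)
Lemma restrictions_homotopic_id Z X Y r q (f : X -> Y) (g : Y -> X) :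
  straight_retraction Z X r -> straight_retraction Z Y q ->
  (forall x, val (f x) = q (val x)) -> (forall y, val (g y) = r (val y)) ->
  homotopic R (g \o f) id.
Proof.
move=> [XZ rc rid rX _] zq fE gE; have [_ _ _ _ qseg] := zq.
pose k (sx : R * X) : V :=
  val sx.2 + clamp (1 - sx.1) *: (q (val sx.2) - val sx.2).
have kZ sx : Z (k sx).
  by apply: qseg; rewrite ?clamp_ge0 ?clamp_le1//; exact: (XZ _ (set_val_mem _)).
have rkX sx : X (r (k sx)) by exact: rX.
(* The segment is run backwards, as the homotopy starts at g \o f. *)
exists (corestrict rkX); split=> [|x|x].
- apply: continuous_subspaceT; apply: corestrict_continuous => sx.
  apply: (@continuous_comp _ _ _ k r); last exact: rc.
  have vc : {for sx, continuous (fun sx : R * X => val sx.2)}.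
    apply: (@continuous_comp _ _ _ snd (fun x : X => val x)); first exact: cvg_snd.
    exact: val_continuous.
  apply: cvgD => //; apply: cvgZ.
    apply: (@continuous_comp _ _ _ (fun sx : R * X => 1 - sx.1) clamp).
      by apply: cvgB; [exact: cvg_cst|exact: cvg_fst].
    exact: clamp_continuous.
  apply: cvgB => //.
  apply: (@continuous_comp _ _ _ snd (fun x : X => q (val x))); first exact: cvg_snd.
  exact: (restrict_continuous zq).
- apply: val_inj; rewrite /= gE fE /k /= subr0 /clamp minxx max_r//.
  by rewrite scale1r addrC subrK.
- apply: val_inj; rewrite /= /k /= subrr /clamp min_r// maxxx scale0r addr0.
  exact: (rid _ (set_val_mem x)).
Qed.

Lemma straight_retracts_homotopy_equivalent Z X Y r q :
  straight_retraction Z X r -> straight_retraction Z Y q ->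
  homotopy_equivalent R X Y.
Proof.
move=> zr zq; have [XZ _ _ rX _] := zr; have [YZ _ _ qY _] := zq.
have fY (x : X) : Y (q (val x)) by exact: (qY _ (XZ _ (set_val_mem x))).
have gX (y : Y) : X (r (val y)) by exact: (rX _ (YZ _ (set_val_mem y))).
exists (corestrict fY), (corestrict gX); split.
- exact/corestrict_continuous/(restrict_continuous zq XZ).
- exact/corestrict_continuous/(restrict_continuous zr YZ).
- exact: (restrictions_homotopic_id zr zq).
- exact: (restrictions_homotopic_id zq zr).
Qed.

(** At most one term of the sum is nonzero, because [r i] is the identity outside
    [U i] and the [U i] are disjoint. The end point [r i x] avoids the other
    open sets since it is a limit of points of [U i]. *)
Lemma pushes_out_glue (I : finType) (U A : I -> set V) (r : I -> V -> V) :
  (forall i, open (U i)) -> trivIset [set: I] U -> (forall i, A i `<=` U i) ->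
  (forall i, pushes_out (U i) (A i) (r i)) ->
  straight_retraction (~` \bigcup_i A i) (~` \bigcup_i U i)
    (fun x => x + \sum_i (r i x - x)).
Proof.
move=> Uo Udisj AU rP; pose rho x := x + \sum_i (r i x - x).
have Ueq i j x : U i x -> U j x -> i = j.
  by move=> Ui Uj; apply: (Udisj i j) => //; exists x.
have rhoX x : (~` \bigcup_i U i) x -> rho x = x.
  move=> Ux; rewrite /rho big1 ?addr0// => i _; have [_ -> //] := rP i.
    by rewrite subrr.
  by move=> Ui; apply: Ux; exists i.
have rhoU i x : U i x -> rho x = r i x.
  move=> Ui; rewrite /rho (bigD1 i)//= big1 => [|j ji].
    by rewrite addr0 addrC subrK.
  have [_ -> //] := rP j; first by rewrite subrr.
  by move=> Uj; move/eqP: ji; apply; exact: (Ueq _ _ x).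
have rnU i x : U i x -> ~ A i x -> forall j, ~ U j (r i x).
  move=> Ui Ai j; have [_ _ /(_ x Ui Ai)[nU half]] := rP i.
  have [->//|ji] := eqVneq j i; move=> Uj.
  pose path (s : R) := x + s *: (r i x - x).
  (* If the end point were in U j, so would be a point just before it, which is
     in U i. *)
  have pathc : path s @[s --> (1 : R)] --> path 1.
    apply: cvgD; first exact: cvg_cst.
    by apply: cvgZ => //; exact: cvg_cst.
  have : nbhs (path 1) (U j).
    by apply: open_nbhs_nbhs; split=> //; rewrite /path scale1r addrC subrK.
  move=> /pathc /nbhs_ballP[e e0 eU].
  pose s : R := Num.max 0 (1 - e / 2).
  have s0 : 0 <= s by rewrite le_max lexx.
  have s1 : s < 1 by rewrite gt_max ltr01/= gtrBl divr_gt0.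
  have /eU Ujs : ball (1 : R) e s.
    rewrite -ball_normE /= gtr0_norm ?subr_gt0//.
    have : 1 - e / 2 <= s by rewrite le_max lexx orbT.
    by lra.
  have [Uis _] := half s s0 s1.
  by move/eqP: ji; apply; exact: (Ueq _ _ (path s)).
have ZU x : (~` \bigcup_i A i) x -> forall i, ~ A i x.
  by move=> Zx i Ai; apply: Zx; exists i.
split.
- by move=> x Ux [i _ /AU Ui]; apply: Ux; exists i.
- move=> z Zz; apply: cvgD => //; apply: (cvg_big add_continuous) => i _.
  by apply: cvgB => //; have [rc _ _] := rP i; apply: rc; exact: ZU.
- exact: rhoX.
- move=> z Zz; rewrite -/(rho z).
  have [Uz|Uz] := pselect ((\bigcup_i U i) z); last by rewrite rhoX.
  case: Uz => i _ Ui; rewrite (rhoU i)// => -[j _]; apply: rnU => //; exact: ZU.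
- move=> z s Zz s0 s1; rewrite -/(rho z).
  have [Uz|Uz] := pselect ((\bigcup_i U i) z); last first.
    by rewrite rhoX// subrr scaler0 addr0.
  case: Uz => i _ Ui; rewrite (rhoU i)// => -[j _ Aj].
  have nAi : ~ A i z by exact: ZU.
  move: s1; rewrite le_eqVlt => /predU1P[s1|s1].
    move: Aj; rewrite s1 scale1r addrC subrK => /AU.
    exact: rnU.
  have [_ _ /(_ z Ui nAi)[_ /(_ s s0 s1)[Uis]]] := rP i; apply.
  by move: (Aj); rewrite -(Ueq i j _ Uis (AU _ _ Aj)).
Qed.

End StraightRetraction.

(** * Projection along the common tail, and the homotopy equivalence *)

Lemma linear_rV_continuous (R : realType) (n : nat) (V : normedModType R)
  (f : {linear 'rV[R]_n -> V}) : continuous f.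
Proof.
rewrite (_ : (f : _ -> _) = fun x => \sum_j x 0 j *: f (delta_mx 0 j)).
  apply: continuous_big => [|j _ x]; first exact: add_continuous.
  have coordc : {for x, continuous (fun M : 'rV[R]_n => M 0 j)}.
    exact: coord_continuous.
  exact: (cvgZ coordc (cvg_cst _)).
apply/funext => x; rewrite {1}(row_sum_delta x) linear_sum.
by apply: eq_bigr => j _; rewrite linearZ.
Qed.

(** The removed sets are unions of cosets of L, and the projection moves points
    only inside their coset; T meets the coset of [b i] in [b i] alone. *)
Lemma projection_straight_retraction (R : realType) (n : nat) (I : Type)
  (J : set I) (L T : {vspace 'rV[R]_n}) (b : I -> 'rV[R]_n) :
  (T + L)%VS = fullv -> directv (T + L) -> (forall i, J i -> b i \in T) ->
  straight_retraction (~` \bigcup_(i in J) [set x | x - b i \in L])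
    ([set` T] `\` [set b i | i in J]) (daddv_pi T L).
Proof.
move=> TL_full /directv_addP TL0 bT; pose q := daddv_pi T L.
have qT x : q x \in T by exact: memv_pi.
have qL x : q x - x \in L.
  have xTL : x \in (T + L)%VS by rewrite TL_full memvf.
  have qE : q x + daddv_pi L T x = x by exact: daddv_pi_add.
  by rewrite -[X in _ - X]qE opprD addNKr memvN memv_pi.
split.
- move=> y [yT yb] [i Ji /= ybL]; apply: yb; exists i => //; apply/esym/eqP.
  have : y - b i \in (T :&: L)%VS by rewrite memv_cap ybL andbT memvB// bT.
  by rewrite TL0 memv0 subr_eq0.
- by move=> z _; exact: linear_rV_continuous.
- by move=> y [yT _]; exact: daddv_pi_id.
- move=> z Zz; split=> [|[i Ji bq]]; first exact: qT.
  by apply: Zz; exists i => //=; rewrite bq -memvN opprB.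
- move=> z s Zz _ _ [i Ji /= zsL]; apply: Zz; exists i => //=.
  by move: zsL; rewrite addrAC rpredDr// memvZ.
Qed.

Theorem corollary4p14 (R : realType) (n : nat) (I : finType)
  (U : I -> set 'rV[R]_n)
  (U_body : forall i, open_convex_body (U i))
  (U_disjoint : trivIset [set: I] U)
  (L : {vspace 'rV[R]_n})
  (tail_eq_L : forall i, is_linear_subspace (tail (U i)) -> tail (U i) = [set` L])
  (T : {vspace 'rV[R]_n})
  (T_L_span : (T + L)%VS = fullv) (T_L_direct : directv (T + L))
  (a b : I -> 'rV[R]_n)
  (a_in_U : forall i, is_linear_subspace (tail (U i)) -> U i (a i))
  (b_def : forall i, is_linear_subspace (tail (U i)) ->
     [set` T] `&` [set a i + v | v in tail (U i)] = [set b i]) :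
  homotopy_equivalent R
    (~` \bigcup_i U i)
    ([set` T] `\` [set b i | i in [set i | is_linear_subspace (tail (U i))]]).
Proof.
pose J : set I := [set i | is_linear_subspace (tail (U i))].
pose A i := [set x | J i /\ tail (U i) (x - a i)].
have bP i : J i -> b i \in T /\ b i - a i \in L.
  move=> Ji; have : [set b i] (b i) by [].
  rewrite -b_def// => -[bT [v + avb]]; rewrite tail_eq_L// => vL; split=> //.
  by rewrite -avb addrAC subrr add0r.
(* Both a i and b i represent the same coset of L. *)
have AE : \bigcup_i A i = \bigcup_(i in J) [set x | x - b i \in L].
  have shift i x : J i -> (x - a i \in L) = (x - b i \in L).
    by move=> /bP[_ baL]; rewrite -(rpredDr (x - b i) baL) addrA subrK.
  apply/seteqP; split=> x [i].
    by move=> _ [Ji]; rewrite tail_eq_L//= shift// => xL; exists i.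
  by move=> Ji xL; exists i => //; split=> //; rewrite tail_eq_L//= shift.
have AU i : A i `<=` U i.
  move=> x [Ji tx]; have := tx (a i) 1 (a_in_U _ Ji) ler01.
  by rewrite scale1r addrC subrK.
have /choice[r rP] i : exists r, pushes_out (U i) (A i) r.
  exact: (body_pushes_out (U_body i) (@a_in_U i)).
have Uo i : open (U i) by have [] := U_body i.
apply: (straight_retracts_homotopy_equivalent (pushes_out_glue Uo U_disjoint AU rP)).
by rewrite AE; apply: projection_straight_retraction => // i /bP[].
Qed.
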